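(* Let $n\ge 1$ be an integer and let $k=2n$. Put $N=k^2+\frac{5}{2}k+1$ (equivalently $N=4n^2+5n+1$), $a=n$ and $b=3n+1$. Then the three-quarters digraph $TQ(N,a,b)$ has diameter $k$. In particular, for every even $k\ge 2$ there exists a three-quarters digraph with diameter $k$ and $k^2+\frac{5}{2}k+1$ vertices.
   Context: For integers $N\ge 2$ and $1\le a,b\le N-1$ with $\gcd(N,a,b)=1$, the three-quarters digraph $TQ(N,a,b)$ has vertex set $\mathbb{Z}_N$ (integers modulo $N$), and each vertex $i$ is joined by arcs to $i+a$ and $i+b$ (mod $N$); it is the circulant digraph with steps $a,b$, equipped with the following distance-like function. For $x,y\in\mathbb{Z}_N$, $d(x,y)$ is the minimum integer $\ell\ge 0$ such that there exist integers $m,n'\ge 0$ with $m+n'=\ell$ and $$y-x\equiv ma+n'b,\quad\text{or}\quad y-x\equiv -ma+n'b,\quad\text{or}\quad y-x\equiv ma-n'b \pmod N.$$ (The combination $-ma-n'b$ with both $m,n'>0$ is not allowed.) The function $d$ is translation invariant, $d(x,y)=d(0,y-x)$, but need not be symmetric. The diameter of $TQ(N,a,b)$ is $\max_{x,y\in\mathbb{Z}_N} d(x,y)=\max_{z\in\mathbb{Z}_N} d(0,z)$. *)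

(* Defs.v *)
From HB Require Import structures.
From mathcomp Require Import all_boot all_order all_algebra.

Set Implicit Arguments.
Unset Strict Implicit.
Unset Printing Implicit Defensive.

Import GRing.Theory.
Local Open Scope ring_scope.

Definition tq_admissible (N a b : nat) : bool :=
  [&& (2 <= N)%N, (1 <= a <= N - 1)%N, (1 <= b <= N - 1)%N
    & gcdn N (gcdn a b) == 1%N].

(* [TQ h] is TQ(N,a,b), where [h : tq_admissible N a b] (a boolean condition,
   so the digraph does not depend on the proof). *)
Record tq_digraph : Type := TQ {
  tq_order : nat;
  tq_stepa : nat;
  tq_stepb : nat;
  tq_admissibleP : tq_admissible tq_order tq_stepa tq_stepb
}.
Arguments TQ {tq_order tq_stepa tq_stepb} tq_admissibleP.

Section Distance.
Variable G : tq_digraph.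

(* ['Z_N] really is the ring of integers modulo N because admissibility
   forces N >= 2. *)
Definition tq_vertex : finType := 'Z_(tq_order G).

Implicit Types (x y : 'Z_(tq_order G)) (l m n : nat).

Let a : 'Z_(tq_order G) := (tq_stepa G)%:R.
Let b : 'Z_(tq_order G) := (tq_stepb G)%:R.

(* The arcs; the distance below is not the directed-path distance for them,
   since some backward steps are allowed as well. *)
Definition tq_arc : rel 'Z_(tq_order G) :=
  fun x y => (y == x + a) || (y == x + b).

Definition tq_combination x y m n : bool :=
  [|| y - x == a *+ m + b *+ n,
      y - x == - (a *+ m) + b *+ n
    | y - x == a *+ m - b *+ n].

(* Bounding m and n by l loses nothing since m + n = l: see [tq_walkP]. *)
Definition tq_walk x y l : bool :=
  [exists m : 'I_l.+1, exists n : 'I_l.+1,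
    ((m + n)%N == l) && tq_combination x y m n].

Lemma tq_walkP x y l :
  reflect (exists m n, (m + n)%N = l /\ tq_combination x y m n)
          (tq_walk x y l).
Proof.
apply: (iffP existsP) => [[m /existsP [n /andP [/eqP e c]]]|[m [n [e c]]]].
  by exists m, n.
have hm : (m < l.+1)%N by rewrite ltnS -e leq_addr.
have hn : (n < l.+1)%N by rewrite ltnS -e leq_addl.
exists (Ordinal hm); apply/existsP; exists (Ordinal hn).
by rewrite /= e eqxx.
Qed.

Lemma tq_walk_ex x y : exists l, tq_walk x y l.
Proof.
have /and4P [N2 /andP [a0 _] _ cop] := tq_admissibleP G.
case: (egcdnP (tq_stepb G) a0) => u v e _.
set g := gcdn _ _ in e cop.
have ug : (g%:R : 'Z_(tq_order G)) \is a GRing.unit by rewrite unitZpE.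
set t : 'Z_(tq_order G) := (y - x) / g%:R.
suff [m [n h]] : exists m n : nat, y - x = a *+ m + b *+ n.
  exists (m + n)%N; apply/tq_walkP; exists m, n; split=> //.
  by rewrite /tq_combination h eqxx.
exists (t * u)%N, (t * (v * (tq_order G).-1))%N.
have N0 : (tq_order G)%:R = 0 :> 'Z_(tq_order G).
  by apply: val_inj; rewrite /= val_Zp_nat // modnn.
have N1 : ((tq_order G).-1)%:R = -1 :> 'Z_(tq_order G).
  by apply/eqP; rewrite -subr_eq0 opprK natr1 prednK ?N0 // ltnW.
have -> : y - x = t * g%:R by rewrite /t mulrVK.
have /(congr1 (fun k : nat => k%:R : 'Z_(tq_order G))) := e.
rewrite natrD !natrM => e'.
have -> : g%:R = a * u%:R - b * v%:R :> 'Z_(tq_order G).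
  by apply/eqP; rewrite eq_sym subr_eq mulrC e' addrC (mulrC b).
rewrite -[a *+ _]mulr_natr -[b *+ _]mulr_natr !natrM N1 natr_Zp.
by rewrite mulrBr mulrN1 !mulrN mulrCA (mulrCA t).
Qed.

Definition tq_dist x y : nat := ex_minn (tq_walk_ex x y).

Definition tq_diameter : nat :=
  \max_(x : 'Z_(tq_order G)) \max_(y : 'Z_(tq_order G)) tq_dist x y.

End Distance.

(* Main.v *)
(** Write the element x a + y b of Z_N as the lattice point (x, y).  Since
    N = (4n + 1)(n + 1), a + b = 4n + 1 and a = - b = n modulo 4n + 1, the
    residue modulo 4n + 1 of the element determines the diagonal c = x - y
    modulo 4n + 1, and two points of one diagonal agree iff their y-coordinates
    agree modulo n + 1.  Taking |c| <= 2n and n + 1 consecutive points of the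
    diagonal with -1 <= x + y <= 2n reaches every element with
    |x| + |y| = max(|x + y|, |x - y|) <= 2n, and x + y >= -1 prevents both
    coordinates from being negative.  Conversely |x| + |y| < 2n forces
    |c| < 2n, so that n (a + b) can only be reached on the diagonal c = 0,
    where the available multiples of a + b stop at n - 1. *)

Require Import Defs.
From HB Require Import structures.
From mathcomp Require Import all_boot all_order all_algebra.
From mathcomp Require Import zify ring.

Set Implicit Arguments.
Unset Strict Implicit.
Unset Printing Implicit Defensive.

Import GRing.Theory.
Local Open Scope ring_scope.

Lemma Zp_intr_eq0 (N : nat) (p : int) :
  (1 < N)%N -> (p%:~R == 0 :> 'Z_N) = (N %| p)%Z.
Proof.
move=> N1; have natE (m : nat) : (m%:R == 0 :> 'Z_N) = (N %| m)%N.
  by rewrite -val_eqE /= val_Zp_nat.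
by case: p => m; rewrite dvdzE -natE // NegzE mulrNz oppr_eq0.
Qed.

(** Signed coefficients merge the three combinations into one: only two negative signs are excluded.
    Minimality of the distance turns equality of lengths into a bound. *)
Lemma tq_dist_leP (G : tq_digraph) (x y : 'Z_(tq_order G)) (l : nat) :
  reflect (exists i j : int,
             [/\ (`|i| + `|j| <= l)%N, (0 <= i) || (0 <= j)
               & y - x = (i * tq_stepa G + j * tq_stepb G)%:~R])
          (tq_dist x y <= l)%N.
Proof.
apply: (iffP idP) => [|[i [j [le_l pos e]]]]; rewrite /tq_dist;
    case: ex_minnP => d.
  case/tq_walkP => m [n [<- comb]] _ le_l.
  have [i [j [em en pos e]]] : exists i j : int, [/\ `|i|%N = m, `|j|%N = n,
      (0 <= i) || (0 <= j)
    & y - x = (tq_stepa G)%:R *~ i + (tq_stepb G)%:R *~ j].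
    case/or3P: comb => /eqP ->; [exists m, n | exists (- m%:Z), n
      | exists m, (- n%:Z)]; rewrite ?mulrNz !pmulrn; split=> //; lia.
  exists i, j; split; rewrite ?em ?en //.
  by rewrite e intrD !intrM !mulrzl.
move=> _ /(_ (`|i| + `|j|)%N) min_d; apply: leq_trans le_l; apply: min_d.
apply/tq_walkP; exists `|i|%N, `|j|%N; split=> //.
rewrite /tq_combination e intrD !intrM !mulrzl.
case: i j pos {e} => [m|m] [n|n] //= _; rewrite ?NegzE ?abszN /= ?mulrNz.
- by rewrite !pmulrn eqxx.
- by rewrite !pmulrn eqxx !orbT.
- by rewrite !pmulrn eqxx !orbT.
Qed.

Lemma tq_diag_cover (n : nat) (z : int) :
  exists x y : int,
  [/\ (`|x| + `|y| <= 2 * n)%N, (0 <= x) || (0 <= y)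
    & ((4 * n ^ 2 + 5 * n + 1)%N
        %| z - (x * n%:Z + y * (3 * n + 1)%N%:Z))%Z].
Proof.
have [c [s [c_le zE]]] : exists c s : int,
    (`|c| <= 2 * n)%N /\ z = n%:Z * c + (4 * n%:Z + 1) * s.
  (* As [4 * n] is -1 modulo [4 * n + 1], [c] must be [- 4 * z] there; the remainder [r] of [4 * z]
     gives [- r], shifted by [4 * n + 1] if too large. *)
  have := divz_eq (4 * z) (4 * n%:Z + 1).
  have := modz_ge0 (4 * z) (_ : 4 * n%:Z + 1 != 0).
  have := ltz_pmod (4 * z) (_ : 0 < 4 * n%:Z + 1).
  move: (_ %/ _)%Z (_ %% _)%Z => q r /(_ ltac:(lia)) r_lt /(_ ltac:(lia)) r_ge zE.
  have e : z + n%:Z * r = (4 * n%:Z + 1) * (z - n%:Z * q).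
    have -> : r = 4 * z - q * (4 * n%:Z + 1) by rewrite zE; ring.
    by ring.
  have [le_r|lt_r] : r <= 2 * n%:Z \/ 2 * n%:Z < r by lia.
    exists (- r), (z - n%:Z * q); split; first by lia.
    by rewrite -e; ring.
  exists (4 * n%:Z + 1 - r), (z - n%:Z * q - n%:Z); split; first by lia.
  by rewrite [X in _ + X]mulrBr -e; ring.
(* This makes [c + 2 * lo] equal to 0 or -1, so [y = lo + r] with [0 <= r <= n] keeps [x + y]
   between -1 and [2 * n]. *)
pose lo := ((- c) %/ 2)%Z.
have loE : - c = lo * 2 \/ - c = lo * 2 + 1 by rewrite /lo; lia.
have := divz_eq (s - lo) (n%:Z + 1).
have := modz_ge0 (s - lo) (_ : n%:Z + 1 != 0).
have := ltz_pmod (s - lo) (_ : 0 < n%:Z + 1).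
move: (_ %/ _)%Z (_ %% _)%Z => q r /(_ ltac:(lia)) r_lt /(_ ltac:(lia)) r_ge sE.
exists (c + (lo + r)), (lo + r); split; [lia | lia |].
apply/dvdzP; exists q; rewrite zE.
have -> : s = lo + (q * (n%:Z + 1) + r) by rewrite -sE; ring.
by rewrite -mulnn !PoszD !PoszM; ring.
Qed.

Lemma tq_diag_far (n : nat) (x y : int) :
  (`|x| + `|y| < 2 * n)%N -> (0 <= x) || (0 <= y) ->
  ~~ ((4 * n ^ 2 + 5 * n + 1)%N
        %| n%:Z * (4 * n%:Z + 1) - (x * n%:Z + y * (3 * n + 1)%N%:Z))%Z.
Proof.
move=> lt_n pos; apply/negP => /dvdzP [q].
rewrite -mulnn !PoszD !PoszM => e.
have {}e : n%:Z * (4 * n%:Z + 1) - (x * n%:Z + y * (3 * n%:Z + 1)) =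
           q * ((4 * n%:Z + 1) * (n%:Z + 1)).
  by rewrite e; ring.
have [t xyE] : exists t : int, x - y = t * (4 * n%:Z + 1).
  (* Write [x - y] as [(4 * n + 1) * (x - y) - 4 * (n * (x - y))] and apply [nE]. *)
  exists (x - y - 4 * (n%:Z - y - q * (n%:Z + 1))).
  have nE : n%:Z * (x - y) = (4 * n%:Z + 1) * (n%:Z - y - q * (n%:Z + 1)).
    by rewrite [RHS]mulrBr [X in _ = _ - X]mulrCA -e; ring.
  have -> : (x - y - 4 * (n%:Z - y - q * (n%:Z + 1))) * (4 * n%:Z + 1) =
    (x - y) * (4 * n%:Z + 1) -
      4 * ((4 * n%:Z + 1) * (n%:Z - y - q * (n%:Z + 1))) by ring.
  by rewrite -nE; ring.
have t0 : t = 0 by nia.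
have xy : x = y by lia.
subst x.
have : (4 * n%:Z + 1) * (n%:Z - y) = (4 * n%:Z + 1) * (q * (n%:Z + 1)).
  by rewrite mulrCA -e; ring.
move=> /mulfI - /(_ ltac:(lia)) yE.
(* Now [0 <= y < n], so [n - y] lies strictly between two consecutive multiples of [n + 1]. *)
have [q_le0|q_gt0] : q <= 0 \/ 1 <= q by lia.
  nia.
nia.
Qed.

Lemma tq_admissible_family (n : nat) : (1 <= n)%N ->
  tq_admissible (4 * n ^ 2 + 5 * n + 1) n (3 * n + 1).
Proof.
move=> n1; apply/and4P; split; [nia | nia | nia |].
suff -> : gcdn n (3 * n + 1) = 1%N by rewrite gcdn1.
by rewrite gcdnMDl gcdn1.
Qed.

Lemma tq_diameter_family (n : nat)
    (h : tq_admissible (4 * n ^ 2 + 5 * n + 1) n (3 * n + 1)) :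
  tq_diameter (TQ h) = (2 * n)%N.
Proof.
have N1 : (1 < 4 * n ^ 2 + 5 * n + 1)%N by case/and4P: h.
apply/eqP; rewrite eqn_leq; apply/andP; split.
  apply/bigmax_leqP => x _; apply/bigmax_leqP => y _; apply/tq_dist_leP.
  pose d : 'Z_(tq_order (TQ h)) := y - x.
  have [i [j [le_n pos dvd]]] := tq_diag_cover n (d : nat).
  exists i, j; split=> //; apply/eqP.
  by rewrite -subr_eq0 -/d -[d]natr_Zp pmulrn -intrB Zp_intr_eq0.
(* The far vertex is [n] times the sum of the two steps. *)
pose w : 'Z_(tq_order (TQ h)) := (n%:Z * (4 * n%:Z + 1))%:~R.
apply: (@leq_trans (tq_dist 0 w)); last first.
  apply: leq_trans (leq_bigmax (0 : 'Z_(tq_order (TQ h)))).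
  exact: (leq_bigmax w).
rewrite leqNgt; apply/negP => lt_n.
have /tq_dist_leP [i [j [le_n pos /eqP]]] := leqnn (tq_dist 0 w).
rewrite subr0 -subr_eq0 -intrB Zp_intr_eq0 //.
by apply/negP/tq_diag_far => //; apply: leq_ltn_trans lt_n.
Qed.

Lemma tq_order_family (n k N : nat) :
  k = (2 * n)%N -> N = (4 * n ^ 2 + 5 * n + 1)%N ->
  N%:R = k%:R ^+ 2 + 5%:R / 2%:R * k%:R + 1 :> rat.
Proof. by move=> -> ->; rewrite -mulnn !natrD !natrM; field. Qed.

Theorem proposition2p1 :
  (forall n k N a b : nat,
     (1 <= n)%N ->
     k = (2 * n)%N ->
     N = (4 * n ^ 2 + 5 * n + 1)%N ->
     a = n ->
     b = (3 * n + 1)%N ->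
     N%:R = k%:R ^+ 2 + 5%:R / 2%:R * k%:R + 1 :> rat /\
     exists h : tq_admissible N a b, tq_diameter (TQ h) = k) /\
  (forall k : nat,
     ~~ odd k ->
     (2 <= k)%N ->
     exists G : tq_digraph,
       tq_diameter G = k /\
       #|tq_vertex G|%:R = k%:R ^+ 2 + 5%:R / 2%:R * k%:R + 1 :> rat).
Proof.
split=> [n k N a b n1 kE NE -> ->|k k_even k2].
  split; first exact: tq_order_family kE NE.
  subst k N; exists (tq_admissible_family n1); exact: tq_diameter_family.
have kE : k = (2 * k./2)%N by rewrite mul2n even_halfK.
have n1 : (1 <= k./2)%N by lia.
exists (TQ (tq_admissible_family n1)); split.
  by rewrite tq_diameter_family -kE.
(* ['Z_N] has [N] elements only when [N] is at least 2. *)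
apply: tq_order_family kE _; rewrite card_ord Zp_cast //=.
by have /and4P [] := tq_admissible_family n1.
Qed.
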